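(* Fix integers $s,t\geq 1$ and $k\geq 3$. Then, as $n\to\infty$, \[ {\rm La}(n,P_k(s,t))\leq \sum_{i=\lfloor \frac{n-(k-2)}{2}\rfloor}^{\lfloor \frac{n+(k-2)}{2}\rfloor}\binom{n}{i} + \binom{n}{\lfloor \frac{n+k}{2}\rfloor}\left(\frac{2k(s+t-2)}{n}+O\!\left(n^{-3/2}\sqrt{\ln n}\right)\right). \] Consequently, ${\rm La}(n,P_k(s,t))/\binom{n}{\lfloor n/2\rfloor}\to k-1$ as $n\to\infty$.
   Context: A poset $(S,\leq)$ contains a poset $(S',\leq')$ (as a subposet) if there is an injection $f\colon S'\to S$ such that $u\leq' v$ implies $f(u)\leq f(v)$ (copies need not be induced). For a poset $H$, a family $\mathcal{F}\subseteq 2^{[n]}$ of subsets of $[n]=\{1,\dots,n\}$ is $H$-free if the poset $(\mathcal{F},\subseteq)$ does not contain $H$. ${\rm La}(n,H)$ denotes the maximum size of an $H$-free family $\mathcal{F}\subseteq 2^{[n]}$. The baton $P_k(s,t)$ ($k\geq 3$, $s,t\geq1$) is the poset obtained from a chain of $k$ elements by replicating the bottom element $s-1$ times and the top element $t-1$ times; that is, it has elements $a_1,\dots,a_s$, $c_2<c_3<\dots<c_{k-1}$, $b_1,\dots,b_t$ with $a_i<c_2$ for all $i$ and $c_{k-1}<b_j$ for all $j$ (the $a_i$ pairwise incomparable, the $b_j$ pairwise incomparable), and the order generated by these relations. The constants in the $O(\cdot)$ may depend on $k,s,t$. *)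

(* Defs.v *)
From HB Require Import structures.
From mathcomp Require Import all_boot all_order.

Set Implicit Arguments.
Unset Strict Implicit.
Unset Printing Implicit Defensive.

Import Order.TTheory.

(* A copy of Q in P need not be induced: f only has to preserve the order. *)
Definition contains (d d' : Order.disp_t)
    (P : finPOrderType d) (Q : finPOrderType d') : bool :=
  [exists f : {ffun Q -> P},
     injectiveb f && [forall u, forall v, (u <= v)%O ==> (f u <= f v)%O]].

Lemma containsP (d d' : Order.disp_t)
    (P : finPOrderType d) (Q : finPOrderType d') :
  reflect (exists f : Q -> P,
             injective f /\ (forall u v, (u <= v)%O -> (f u <= f v)%O))
          (contains P Q).
Proof.
apply: (iffP existsP) => [[f /andP[/injectiveP injf /forallP homf]]|[f [injf homf]]].
  exists f; split=> // u v uv.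
  by move/forallP: (homf u) => /(_ v)/implyP/(_ uv).
exists (finfun f); apply/andP; split.
  by apply/injectiveP => u v; rewrite !ffunE => /injf.
by apply/forallP => u; apply/forallP => v; apply/implyP => /homf; rewrite !ffunE.
Qed.

Definition family_poset (n : nat) (F : {set {set 'I_n}}) : Type :=
  {A : {set 'I_n} | A \in F}.

HB.instance Definition _ (n : nat) (F : {set {set 'I_n}}) :=
  SubFinite.on (family_poset F).

Definition family_le (n : nat) (F : {set {set 'I_n}}) : rel (family_poset F) :=
  fun A B => val A \subset val B.

Fact family_le_refl (n : nat) (F : {set {set 'I_n}}) : reflexive (@family_le n F).
Proof. by move=> A; exact: subxx. Qed.

Fact family_le_anti (n : nat) (F : {set {set 'I_n}}) :
  antisymmetric (@family_le n F).
Proof. by move=> A B AB; apply/val_inj/eqP; rewrite eqEsubset. Qed.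

Fact family_le_trans (n : nat) (F : {set {set 'I_n}}) : transitive (@family_le n F).
Proof. by move=> B A C; exact: subset_trans. Qed.

HB.instance Definition _ (n : nat) (F : {set {set 'I_n}}) :=
  Order.Le_isPOrder.Build Order.SetSubsetOrder.subset_display (family_poset F)
    (@family_le_refl n F) (@family_le_anti n F) (@family_le_trans n F).

Definition poset_free (d : Order.disp_t) (H : finPOrderType d)
    (n : nat) (F : {set {set 'I_n}}) : bool :=
  ~~ contains (family_poset F) H.

Definition La (d : Order.disp_t) (n : nat) (H : finPOrderType d) : nat :=
  \max_(F : {set {set 'I_n}} | poset_free H F) #|F|.

(* inl (inl i) is a_(i+1), inl (inr i) is c_(i+2), and inr j is b_(j+1). *)
Definition baton (k s t : nat) : Type := ('I_s + 'I_(k - 2) + 'I_t)%type.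

HB.instance Definition _ (k s t : nat) := Finite.on (baton k s t).

(* The generating relations a_i < c_2, c_i < c_(i+1), c_(k-1) < b_j. *)
Definition baton_gen (k s t : nat) : rel (baton k s t) := fun x y =>
  match x, y with
  | inl (inl _), inl (inr c) => c == 0 :> nat
  | inl (inr c), inl (inr c') => c' == c.+1 :> nat
  | inl (inr c), inr _ => c.+1 == k - 2
  | _, _ => false
  end.

Definition baton_le (k s t : nat) : rel (baton k s t) := connect (@baton_gen k s t).

Definition baton_rank (k s t : nat) (x : baton k s t) : nat :=
  match x with
  | inl (inl _) => 0
  | inl (inr c) => c.+1
  | inr _ => k.+1
  end.

Lemma baton_gen_rank (k s t : nat) (x y : baton k s t) :
  baton_gen x y -> baton_rank x < baton_rank y.
Proof.
case: x => [[i|c]|j]; case: y => [[i'|c']|j'] //=; first by move/eqP=> ->.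
by move=> _; rewrite ltnS (leq_trans (ltn_ord c)) ?leq_subr.
Qed.

Lemma baton_le_rank (k s t : nat) (x y : baton k s t) :
  baton_le x y -> x = y \/ baton_rank x < baton_rank y.
Proof.
move=> /connectP[p + ->]; elim: p x => [|z p IH] x /=; first by left.
move=> /andP[/baton_gen_rank xz /IH[<-|zl]]; first by right.
by right; apply: ltn_trans xz zl.
Qed.

Fact baton_le_refl (k s t : nat) : reflexive (@baton_le k s t).
Proof. by move=> x; exact: connect0. Qed.

Fact baton_le_anti (k s t : nat) : antisymmetric (@baton_le k s t).
Proof.
move=> x y /andP[/baton_le_rank[//|xy] /baton_le_rank[//|yx]].
by have := ltn_trans xy yx; rewrite ltnn.
Qed.

Fact baton_le_trans (k s t : nat) : transitive (@baton_le k s t).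
Proof. by move=> y x z; exact: connect_trans. Qed.

Fact baton_display : Order.disp_t. Proof. exact: Order.Disp tt tt. Qed.

HB.instance Definition _ (k s t : nat) :=
  Order.Le_isPOrder.Build baton_display (baton k s t)
    (@baton_le_refl k s t) (@baton_le_anti k s t) (@baton_le_trans k s t).

Lemma le_family_posetE (n : nat) (F : {set {set 'I_n}}) (A B : family_poset F) :
  (A <= B)%O = (val A \subset val B).
Proof. by []. Qed.

Lemma le_batonE (k s t : nat) (x y : baton k s t) :
  (x <= y)%O = connect (@baton_gen k s t) x y.
Proof. by []. Qed.

(* Main.v *)
(* A uniformly random maximal chain of subsets of [n] meets a given set A with
   probability 1 / 'C(n, #|A|). Averaging over such chains shows that a family
   in which each member has at most r members below it, all of size at least
   m > r, has Lubell weight at most m / (m - r). A baton-free family, trimmed to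
   sizes between n / 4 and 3 n / 4 (the discarded sets are exponentially few),
   consists of the members with fewer than s members below, those with fewer
   than t members above, and a core without chains of k - 2 sets; the weights of
   the three parts are at most 1 + O(1 / n), 1 + O(1 / n) and k - 3. A family of
   weight k - 1 + x has at most as many sets as the k - 1 middle levels plus x
   times the next largest level. Conversely the k - 1 middle levels contain no
   baton, and each of them has asymptotically 'C(n, n / 2) sets. *)

Require Import Defs.
From mathcomp Require Import all_classical all_reals all_analysis.
(* Imported last, so that subsetP, setIC, ... refer to finite sets. *)
From mathcomp Require Import all_boot all_order all_fingroup all_algebra.
From mathcomp Require Import zify ring lra.

Set Implicit Arguments.
Unset Strict Implicit.
Unset Printing Implicit Defensive.

Import Order.TTheory GRing.Theory Num.Theory.
Import numFieldNormedType.Exports.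

Lemma leq_card_ord n (A : {set 'I_n}) : #|A| <= n.
Proof. by rewrite -[leqRHS]card_ord max_card. Qed.

Lemma card_setC_ord n (A : {set 'I_n}) : #|~: A| = n - #|A|.
Proof. by rewrite cardsCs setCK card_ord. Qed.

Lemma leq_card_bigcup (I T : finType) (P : pred I) (F : I -> {set T}) :
  #|\bigcup_(i | P i) F i| <= \sum_(i | P i) #|F i|.
Proof.
elim/big_ind2: _ => [|A a B b Aa Bb|//]; first by rewrite cards0.
by rewrite (leq_trans (leq_card_setU _ _)) // leq_add.
Qed.

Lemma leq_n_bin n m : 0 < m < n -> n <= 'C(n, m).
Proof.
case/andP; elim: n m => // n IH [//|[|m]] _ mn; first by rewrite bin1.
by rewrite binS -add1n leq_add ?bin_gt0 ?IH.
Qed.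

Section Comparability.
Variables (T : finType).
Implicit Types (F G : {set {set T}}) (A B : {set T}).

Definition below F B := [set A in F | A \proper B].

Definition above F B := [set A in F | B \proper A].

Lemma mem_below F A B : (A \in below F B) = (A \in F) && (A \proper B).
Proof. by rewrite inE. Qed.

Lemma mem_above F A B : (A \in above F B) = (A \in F) && (B \proper A).
Proof. by rewrite inE. Qed.

Lemma belowS F G B : F \subset G -> below F B \subset below G B.
Proof. by move=> FG; rewrite /below !setIdE setSI. Qed.

Lemma aboveS F G B : F \subset G -> above F B \subset above G B.
Proof. by move=> FG; rewrite /above !setIdE setSI. Qed.

Lemma below_setC F B : below (@setC T @: F) (~: B) = @setC T @: above F B.
Proof.
apply/setP => A; rewrite mem_below; apply/andP/imsetP => [[/imsetP[C CF ->]]|].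
  by rewrite properE !setCS -properE => BC; exists C; rewrite // mem_above CF.
move=> [C /[1!mem_above] /andP[CF BC] ->].
by rewrite imset_f // properE !setCS -properE.
Qed.

Definition is_chain (c : seq {set T}) : bool :=
  sorted (fun A B => A \proper B) c.

Definition chain_bound (h : nat) F : Prop :=
  forall c, is_chain c -> {subset c <= F} -> size c <= h.

Definition minimal_members F := [set A in F | below F A == set0].

Lemma minimal_members_sub F : minimal_members F \subset F.
Proof. by rewrite /minimal_members setIdE subsetIl. Qed.

Lemma minimal_members_antichain F :
  {in minimal_members F, forall B, below (minimal_members F) B = set0}.
Proof.
move=> B; rewrite inE => /andP[_ /eqP B0].
by apply/eqP; rewrite -subset0 -B0 belowS ?minimal_members_sub.
Qed.

Lemma chain_bound0 F : chain_bound 0 F -> F = set0.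
Proof.
move=> chF; apply/setP => A; rewrite inE; apply/negP => AF.
have sub : {subset [:: A] <= F} by move=> B /[1!inE] /eqP ->.
by have := chF [:: A] isT sub.
Qed.

Lemma chain_bound_minimal h F :
  chain_bound h.+1 F -> chain_bound h (F :\: minimal_members F).
Proof.
move=> chF [//|A c] cs cG.
have /cG/setDP[AF] := mem_head A c.
rewrite inE AF => /set0Pn[B /[1!mem_below] /andP[BF BA]].
have /= := chF [:: B, A & c]; rewrite /is_chain /= BA ltnS => /(_ cs); apply.
by move=> X; rewrite inE => /predU1P[-> //|/cG/setDP[]].
Qed.

Definition few_below s F := [set B in F | #|below F B| < s].

Definition few_above t F := [set B in F | #|above F B| < t].

Definition core s t F := F :\: (few_below s F :|: few_above t F).

Lemma few_below_sub s F : few_below s F \subset F.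
Proof. by rewrite /few_below setIdE subsetIl. Qed.

Lemma few_above_sub t F : few_above t F \subset F.
Proof. by rewrite /few_above setIdE subsetIl. Qed.

Lemma mem_core s t F B :
  (B \in core s t F) = [&& B \in F, s <= #|below F B| & t <= #|above F B|].
Proof.
rewrite !inE; case: (B \in F); last by rewrite andbF.
by rewrite /= negb_or -!leqNgt andbT.
Qed.

Lemma core_decomposition s t F :
  F = core s t F :|: (few_below s F :|: few_above t F).
Proof.
rewrite setUC /core setDE setUIr setUCr setIT (setUidPr _) //.
by rewrite subUset few_below_sub few_above_sub.
Qed.

Lemma card_below_few_below s F : 0 < s ->
  {in few_below s F, forall B, #|below (few_below s F) B| <= s.-1}.
Proof.
move=> s0 B /setIdP[_ ltB]; rewrite -ltnS prednK //; apply: leq_ltn_trans ltB.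
by rewrite subset_leq_card ?belowS ?few_below_sub.
Qed.

Lemma card_above_few_above t F : 0 < t ->
  {in few_above t F, forall B, #|above (few_above t F) B| <= t.-1}.
Proof.
move=> t0 B /setIdP[_ ltB]; rewrite -ltnS prednK //; apply: leq_ltn_trans ltB.
by rewrite subset_leq_card ?aboveS ?few_above_sub.
Qed.

End Comparability.

Section RandomChain.
Variable n : nat.
Implicit Types (p q : {perm 'I_n}) (A B : {set 'I_n}) (L : {set {set 'I_n}}).

(* A permutation p encodes the maximal chain of the sets chain_nth p m, so a
   uniformly random maximal chain is a uniformly random permutation. *)
Definition chain_nth p m : {set 'I_n} := p @: [set i : 'I_n | i < m].

Definition chains_through A := [set p | chain_nth p #|A| == A].

Lemma mem_chains_through p A :
  (p \in chains_through A) = (chain_nth p #|A| == A).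
Proof. by rewrite inE. Qed.

Lemma card_chain_nth p m : m <= n -> #|chain_nth p m| = m.
Proof.
move=> mn; rewrite card_imset; last exact: perm_inj.
by rewrite cardsE -sum1_card -(big_ord_widen n (fun=> 1) mn) sum1_card card_ord.
Qed.

Lemma chain_nth_subset p l m : l <= m -> chain_nth p l \subset chain_nth p m.
Proof. by move=> lm; apply/imsetS/subsetP => i /[!inE] /leq_trans; apply. Qed.

Lemma chain_nthM p q m : chain_nth (p * q)%g m = q @: chain_nth p m.
Proof. by rewrite -imset_comp; apply: eq_imset => i; rewrite /= permM. Qed.

Lemma chains_through_subset p A B :
  p \in chains_through A -> p \in chains_through B ->
  #|A| <= #|B| -> A \subset B.
Proof.
by rewrite !inE => /eqP pA /eqP pB AB; rewrite -pA -pB chain_nth_subset.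
Qed.

Lemma exists_chain_take (s : seq 'I_n) : uniq s -> s =i 'I_n ->
  exists p, forall m, chain_nth p m = [set i in take m s].
Proof.
move=> uniq_s s_all.
have size_s : size s = n.
  rewrite -[RHS]size_enum_ord; apply/perm_size/uniq_perm; rewrite ?enum_uniq //.
  by move=> i; rewrite mem_enum s_all.
have lt_s (i : 'I_n) : i < size s by rewrite size_s.
have nth_inj : injective (fun i : 'I_n => nth i s i).
  move=> i j /eqP; rewrite (set_nth_default i j) // nth_uniq //.
  by move=> /eqP/val_inj.
exists (perm nth_inj) => m; apply/setP => x.
rewrite inE in_take ?s_all //; apply/imsetP/idP => [[i /[1!inE] im ->]|xm].
  by rewrite permE index_uniq.
have xn : index x s < n by rewrite -[ltnRHS]size_s index_mem s_all.
by exists (Ordinal xn); rewrite ?inE // permE /= nth_index ?s_all.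
Qed.

Lemma exists_chain_through2 A B : A \subset B ->
  exists2 p, p \in chains_through A & p \in chains_through B.
Proof.
move=> AB; pose s := enum A ++ enum (B :\: A) ++ enum (~: B).
have uniq_s : uniq s.
  rewrite !cat_uniq !enum_uniq has_cat negb_or -!all_predC /= andbT -andbA.
  apply/and3P; split; apply/allP => x; rewrite /= !(mem_enum, inE).
  - by case/andP.
  - by apply: contra => /(subsetP AB).
  - by apply: contra => /andP[].
have s_all : s =i 'I_n.
  by move=> x; rewrite !mem_cat !mem_enum !inE; do 2 case: (x \in _).
have [p ps] := exists_chain_take uniq_s s_all.
exists p; rewrite mem_chains_through ps; apply/eqP/setP => x; rewrite inE.
  by rewrite take_size_cat -?cardE // mem_enum.
rewrite /s catA take_size_cat ?mem_cat ?mem_enum ?inE.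
  by have := subsetP AB x; case: (x \in A) => // ->.
by rewrite size_cat -!cardE cardsDS // subnKC ?subset_leq_card.
Qed.

Lemma exists_perm_flag A A' B : A \subset B -> A' \subset B -> #|A'| = #|A| ->
  exists2 q : {perm 'I_n}, q @: A = A' & q @: B = B.
Proof.
move=> /exists_chain_through2[p pA pB] /exists_chain_through2[p' pA' pB'] AA'.
have transport C C' : p \in chains_through C -> p' \in chains_through C' ->
    #|C'| = #|C| -> (p^-1 * p')%g @: C = C'.
  rewrite !inE => /eqP pC /eqP pC' CC'.
  by rewrite -[in LHS]pC -chain_nthM mulKVg -CC'.
by exists (p^-1 * p')%g; apply: transport.
Qed.

Lemma chains_throughM p q A :
  ((p * q)%g \in chains_through (q @: A)) = (p \in chains_through A).
Proof.
rewrite !mem_chains_through chain_nthM card_imset; last exact: perm_inj.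
by apply/eqP/eqP => [|-> //]; apply: imset_inj; exact: perm_inj.
Qed.

Lemma eq_card_chains_through2 A A' B :
    A \subset B -> A' \subset B -> #|A'| = #|A| ->
  #|chains_through A' :&: chains_through B| =
    #|chains_through A :&: chains_through B|.
Proof.
move=> AB A'B /(exists_perm_flag AB A'B)[q qA qB].
rewrite -(card_preimset _ (mulIg q)); apply: eq_card => p.
by rewrite inE !in_setI -qA -[in LHS]qB !chains_throughM.
Qed.

Lemma card_chains_through2 A B : A \subset B ->
  #|chains_through A :&: chains_through B| * 'C(#|B|, #|A|) =
    #|chains_through B|.
Proof.
move=> AB; pose draws := [set A' : {set 'I_n} | A' \subset B & #|A'| == #|A|].
have draw_p p : p \in chains_through B -> chain_nth p #|A| \in draws.
  rewrite mem_chains_through inE card_chain_nth ?leq_card_ord // eqxx andbT.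
  by move=> /eqP <-; rewrite chain_nth_subset ?subset_leq_card.
rewrite -cards_draws mulnC -[RHS]sum1_card (partition_big _ _ draw_p) /=.
rewrite -sum_nat_const.
apply: eq_bigr => A' /[1!inE] /andP[A'B /eqP cA'].
rewrite -(eq_card_chains_through2 AB A'B cA') -sum1_card; apply: eq_bigl => p.
by rewrite in_setI andbC (mem_chains_through p A') cA'.
Qed.

Lemma card_chains_through A : #|chains_through A| * 'C(n, #|A|) = n`!.
Proof.
have chainsT : chains_through setT = setT.
  apply/setP => p; rewrite !inE eqEcard subsetT.
  by rewrite card_chain_nth ?leqnn ?leq_card_ord.
have := card_chains_through2 (subsetT A).
rewrite chainsT setIT cardsT card_ord => ->.
by rewrite cardsT -(card_Sn n); apply: eq_card => p; rewrite !inE.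
Qed.

Definition chains_first_at L B :=
  chains_through B :\: \bigcup_(A in below L B) chains_through A.

Lemma chains_first_at_inj L A B p : A \in L -> B \in L ->
  p \in chains_first_at L A -> p \in chains_first_at L B -> A = B.
Proof.
wlog AB : A B / #|A| <= #|B|.
  move=> IH AL BL pA pB; have [AB|/ltnW BA] := leqP #|A| #|B|; first exact: IH.
  exact/esym/IH.
move=> AL _ /setDP[pA _] /setDP[pB /bigcupP lowest].
have sAB := chains_through_subset pA pB AB.
apply/eqP; rewrite eqEsubset sAB; apply: contra_notT lowest => BA.
by exists A; rewrite // mem_below AL properE sAB.
Qed.

Lemma sum_card_chains_first_at L : \sum_(B in L) #|chains_first_at L B| <= n`!.
Proof.
rewrite -(card_Sn n).
under eq_bigr => B _ do rewrite -sum1_card.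
rewrite (exchange_big_dep predT) //= -[leqRHS]sum1_card.
rewrite [leqRHS](eq_bigl xpredT) => [|p]; last by rewrite !inE.
apply: leq_sum => p _; rewrite sum1_card; apply/card_le1_eqP => A B.
rewrite !unfold_in => /andP[AL pA] /andP[BL pB].
exact: chains_first_at_inj BL AL pB pA.
Qed.

Lemma leq_mul_card_chains_through2 A B : 0 < #|A| -> A \proper B ->
  #|B| * #|chains_through A :&: chains_through B| <= #|chains_through B|.
Proof.
move=> A0 AB; rewrite -(card_chains_through2 (proper_sub AB)) mulnC leq_mul2l.
by rewrite leq_n_bin ?orbT // A0 proper_card.
Qed.

Lemma leq_card_chains_first_at m r L B :
    0 < m -> {in L &, forall A C : {set 'I_n}, A \proper C -> m <= #|A|} ->
    B \in L -> #|below L B| <= r ->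
  m * #|chains_through B| <=
    m * #|chains_first_at L B| + r * #|chains_through B|.
Proof.
move=> m0 mL BL rB.
rewrite -{1}(cardsID (\bigcup_(A in below L B) chains_through A)).
rewrite mulnDr addnC leq_add2l big_distrr /=.
apply: leq_trans (leq_mul (leqnn m) (leq_card_bigcup _ _)) _.
apply: (@leq_trans (\sum_(A in below L B) #|chains_through B|)); last first.
  by rewrite sum_nat_const leq_mul2r rB orbT.
rewrite big_distrr; apply: leq_sum => A /[1!mem_below] /andP[AL AB] /=.
have mA := mL A B AL BL AB.
apply: leq_trans (leq_mul_card_chains_through2 (leq_trans m0 mA) AB).
by rewrite setIC leq_mul2r (leq_trans mA) ?orbT // subset_leq_card ?proper_sub.
Qed.

Lemma sum_card_chains_through_few_below m r L :
    0 < m -> {in L &, forall A B : {set 'I_n}, A \proper B -> m <= #|A|} ->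
    {in L, forall B, #|below L B| <= r} ->
  m * (\sum_(B in L) #|chains_through B|) <=
    m * n`! + r * (\sum_(B in L) #|chains_through B|).
Proof.
move=> m0 mL rL.
apply: (@leq_trans (m * (\sum_(B in L) #|chains_first_at L B|)
                    + r * (\sum_(B in L) #|chains_through B|))).
  rewrite !big_distrr -big_split /=.
  by apply: leq_sum => B BL; apply: leq_card_chains_first_at (rL B BL).
by rewrite leq_add2r leq_mul2l sum_card_chains_first_at orbT.
Qed.

End RandomChain.

Definition lubell (R : realFieldType) n (F : {set {set 'I_n}}) : R :=
  (\sum_(A in F) ('C(n, #|A|))%:R^-1)%R.

Section Lubell.
Variables (R : realFieldType) (n : nat).
Implicit Types (F G L : {set {set 'I_n}}) (A B : {set 'I_n}).
Local Open Scope ring_scope.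

Lemma natr_bin_gt0 i : (i <= n)%N -> 0 < 'C(n, i)%:R :> R.
Proof. by move=> i_n; rewrite ltr0n bin_gt0. Qed.

Lemma lubellU_le F G : lubell R (F :|: G) <= lubell R F + lubell R G.
Proof.
rewrite {1}/lubell (big_setID F) setUK /= lerD2l setDUl setDv set0U.
by rewrite [leRHS](big_setID F) /= lerDr sumr_ge0.
Qed.

Lemma lubell_setC F : lubell R (@setC _ @: F) = lubell R F.
Proof.
rewrite /lubell big_imset /=; last by move=> ? ? _ _ /setC_inj.
by apply: eq_bigr => A _; rewrite card_setC_ord bin_sub ?leq_card_ord.
Qed.

Lemma sum_card_chains_throughE F :
  (\sum_(A in F) #|chains_through A|)%:R = n`!%:R * lubell R F.
Proof.
rewrite natr_sum /lubell mulr_sumr; apply: eq_bigr => A _.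
rewrite -(card_chains_through A) natrM mulfK // gt_eqF //.
by rewrite natr_bin_gt0 ?leq_card_ord.
Qed.

(* On a random maximal chain the events "B is the lowest member of L" are
   disjoint, and each has probability at least (1 - r / m) / 'C(n, #|B|). *)
Lemma lubell_card_below_le m r L : (r < m)%N ->
    {in L &, forall A B, A \proper B -> (m <= #|A|)%N} ->
    {in L, forall B, (#|below L B| <= r)%N} ->
  lubell R L <= m%:R / (m - r)%:R.
Proof.
move=> rm mL rL; rewrite ler_pdivlMr; last by rewrite ltr0n subn_gt0.
have := sum_card_chains_through_few_below (leq_ltn_trans (leq0n r) rm) mL rL.
rewrite -(ler_nat R) natrD !natrM sum_card_chains_throughE => weight.
rewrite -(@ler_pM2l R n`!%:R) ?ltr0n ?fact_gt0 // natrB; last exact: ltnW.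
lra.
Qed.

Lemma lubell_card_above_le m r L : (r < m)%N ->
    {in L &, forall A B, A \proper B -> (m <= n - #|B|)%N} ->
    {in L, forall B, (#|above L B| <= r)%N} ->
  lubell R L <= m%:R / (m - r)%:R.
Proof.
move=> rm mL rL; rewrite -lubell_setC; apply: lubell_card_below_le => //.
  move=> _ _ /imsetP[A AL ->] /imsetP[B BL ->].
  by rewrite card_setC_ord properE !setCS -properE; exact: mL.
move=> _ /imsetP[B BL ->]; rewrite below_setC card_imset; last exact: setC_inj.
exact: rL.
Qed.

Lemma lubell_antichain L :
  {in L, forall B, below L B = set0} -> lubell R L <= 1.
Proof.
move=> antiL; rewrite -[leRHS](@divff _ 1%:R) ?oner_eq0 // -{2}[1%N]subn0.
apply: lubell_card_below_le => // [A B AL BL AB|B BL]; last first.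
  by rewrite antiL ?cards0.
by have := mem_below L A B; rewrite antiL // inE AL AB.
Qed.

Lemma lubell_chain_bound h F : chain_bound h F -> lubell R F <= h%:R.
Proof.
elim: h F => [|h IH] F chF.
  by rewrite (chain_bound0 chF) /lubell big_set0.
have <- : minimal_members F :|: (F :\: minimal_members F) = F.
  by rewrite -[RHS](setID F (minimal_members F)) (setIidPr _) //
    minimal_members_sub.
apply: le_trans (lubellU_le _ _) _; rewrite -natr1 addrC lerD //.
  exact/IH/chain_bound_minimal.
exact/lubell_antichain/minimal_members_antichain.
Qed.

Lemma lubell_core_le s t F :
  lubell R F <= lubell R (core s t F) + lubell R (few_below s F)
                + lubell R (few_above t F).
Proof.
rewrite [X in lubell R X <= _](core_decomposition s t) -addrA.
by apply: le_trans (lubellU_le _ _) _; rewrite lerD2l lubellU_le.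
Qed.

Lemma lubell_few_below m s F : (0 < s)%N -> (s.-1 < m)%N ->
    {in F, forall A : {set 'I_n}, (m <= #|A|)%N} ->
  lubell R (few_below s F) <= m%:R / (m - s.-1)%:R.
Proof.
move=> s0 sm mF; apply: lubell_card_below_le => //.
  by move=> A B /(subsetP (few_below_sub s F))/mF.
exact: card_below_few_below.
Qed.

Lemma lubell_few_above m t F : (0 < t)%N -> (t.-1 < m)%N ->
    {in F, forall A : {set 'I_n}, (m <= n - #|A|)%N} ->
  lubell R (few_above t F) <= m%:R / (m - t.-1)%:R.
Proof.
move=> t0 tm mF; apply: lubell_card_above_le => //.
  by move=> A B _ /(subsetP (few_above_sub t F))/mF.
exact: card_above_few_above.
Qed.

End Lubell.

Lemma exists_inj_ord (T : finType) (A : {set T}) m : m <= #|A| ->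
  exists2 f : 'I_m -> T, injective f & forall i, f i \in A.
Proof.
move=> mA; exists (fun i => enum_val (widen_ord mA i)) => [i j|i].
  by move=> /enum_val_inj/(congr1 val) /= /val_inj.
exact: enum_valP.
Qed.

Section BatonEmbedding.
Variables (d : Order.disp_t) (P : finPOrderType d).
Local Open Scope order_scope.

Lemma contains_baton k s t
    (a : 'I_s -> P) (c : 'I_(k - 2) -> P) (b : 'I_t -> P) :
    (2 < k)%N -> injective a -> injective b ->
    {homo c : i j / (i < j)%N >-> i < j} ->
    (forall i j, a i < c j) -> (forall i j, c i < b j) ->
  contains P (baton k s t).
Proof.
move=> k2 a_inj b_inj c_homo ac cb.
have ab i j : a i < b j.
  have k20 : (0 < k - 2)%N by rewrite subn_gt0.
  exact: lt_trans (ac i (Ordinal k20)) (cb _ _).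
have c_inj : injective c.
  move=> i j cij; apply/val_inj.
  by case: (ltngtP i j) => // /c_homo; rewrite cij ltxx.
pose g (x : baton k s t) : P :=
  match x with inl (inl i) => a i | inl (inr i) => c i | inr i => b i end.
apply/containsP; exists g; split.
  have eqNlt (x y : P) : x = y -> ~ x < y by move=> ->; rewrite ltxx.
  by case=> [[i|i]|i] [[j|j]|j] /= =>
    [/a_inj ->|/eqNlt[]|/eqNlt[]
    |/esym/eqNlt[]|/c_inj ->|/eqNlt[]
    |/esym/eqNlt[]|/esym/eqNlt[]|/b_inj ->].
have g_gen x y : baton_gen x y -> g x <= g y.
  case: x y => [[i|i]|i] [[j|j]|j] //= ij; apply: ltW => //.
  by apply: c_homo; rewrite (eqP ij).
move=> x y; rewrite le_batonE => /connectP[p + ->].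
by elim: p x => [|z p IH] x //= /andP[/g_gen xz /IH]; exact: le_trans.
Qed.

Lemma contains_baton_of_chain s t (x : P) (c : seq P) :
    path <%O x c -> (s <= #|[set y | (y < x)%O]|)%N ->
    (t <= #|[set y | (last x c < y)%O]|)%N ->
  contains P (baton (size c).+3 s t).
Proof.
move=> xc /exists_inj_ord[a a_inj a_lt] /exists_inj_ord[b b_inj b_gt].
pose nth_c (i : 'I_(size c).+1) := nth x (x :: c) i.
have nth_homo (i j : 'I_(size c).+1) : (i <= j)%N -> nth_c i <= nth_c j.
  by rewrite /nth_c lt_sorted_leq_nth // inE ltn_ord.
apply: (@contains_baton (size c).+3 s t a nth_c b) => //.
- by move=> i j; rewrite /nth_c lt_sorted_ltn_nth // inE ltn_ord.
- move=> i j; apply: lt_le_trans (nth_homo ord0 j _) => //.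
  by have := a_lt i; rewrite inE.
- move=> i j; apply: le_lt_trans (nth_homo i ord_max _) _.
    by rewrite -ltnS.
  by have := b_gt j; rewrite inE (last_nth x).
Qed.

End BatonEmbedding.

Section FamilyPoset.
Variables (n : nat) (F : {set {set 'I_n}}).
Implicit Types (x y : family_poset F) (A : {set 'I_n}) (c : seq {set 'I_n}).

Lemma lt_family_posetE x y : (x < y)%O = (val x \proper val y).
Proof. by rewrite lt_neqAle le_family_posetE properEneq. Qed.

Lemma card_family_poset (p : pred {set 'I_n}) :
  #|[set x : family_poset F | p (val x)]| = #|[set A in F | p A]|.
Proof.
rewrite -(card_imset _ val_inj); apply: eq_card => A; rewrite inE.
apply/imsetP/andP => [[x /[1!inE] px ->]|[AF pA]]; first by rewrite (valP x).
by exists (exist _ A AF); rewrite // inE.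
Qed.

Lemma card_lt_family_poset x : #|[set y | (y < x)%O]| = #|below F (val x)|.
Proof.
rewrite -card_family_poset; apply: eq_card => y.
by rewrite !inE lt_family_posetE.
Qed.

Lemma card_gt_family_poset x : #|[set y | (x < y)%O]| = #|above F (val x)|.
Proof.
rewrite -card_family_poset; apply: eq_card => y.
by rewrite !inE lt_family_posetE.
Qed.

Lemma family_contains_baton s t A c :
    is_chain (A :: c) -> {subset A :: c <= F} ->
    s <= #|below F A| -> t <= #|above F (last A c)| ->
  contains (family_poset F) (baton (size c).+3 s t).
Proof.
have val_mono x y : (val x \proper val y) = (x < y)%O.
  by rewrite lt_family_posetE.
move=> + /allP/all_sigP[e eE]; case: e eE => // x e [-> ->].
rewrite /is_chain /= size_map last_map (mono_path val_mono) => x_e s_le t_le.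
apply: (@contains_baton_of_chain _ (family_poset F) s t x) => //.
  by rewrite card_lt_family_poset.
by rewrite card_gt_family_poset.
Qed.

End FamilyPoset.

Lemma poset_freeS (d : Order.disp_t) (H : finPOrderType d) n
    (F G : {set {set 'I_n}}) :
  G \subset F -> poset_free H F -> poset_free H G.
Proof.
move=> /subsetP GF; apply: contra => /containsP[f [f_inj f_homo]].
apply/containsP; exists (fun u => exist _ (val (f u)) (GF _ (valP (f u)))).
split=> [u v /(congr1 val) /= /val_inj/f_inj //|u v /f_homo].
by rewrite !le_family_posetE.
Qed.

Section LubellBatonFree.
Variables (R : realFieldType) (n k s t : nat).
Hypotheses (k_gt2 : 2 < k) (s_gt0 : 0 < s) (t_gt0 : 0 < t).
Implicit Types (F : {set {set 'I_n}}).

Lemma core_chain_bound F :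
  poset_free (baton k s t) F -> chain_bound (k - 3) (core s t F).
Proof.
move=> freeF c chain_c cF; rewrite leqNgt; apply: contra freeF => ltc.
have := size_takel ltc; have := take_sorted (k - 3).+1 chain_c.
have {}cF : {subset take (k - 3).+1 c <= core s t F} by move=> A /mem_take/cF.
case: (take _ c) cF => // A e eF chain_e [size_e].
rewrite -(subnK k_gt2) addn3 -size_e.
have := eF _ (mem_last A e); have := eF _ (mem_head A e); rewrite !mem_core.
move=> /and3P[_ sA _] /and3P[_ _ tA].
apply: family_contains_baton chain_e _ sA tA.
by move=> B /eF/setDP[].
Qed.

Lemma lubell_baton_free m F :
    s.-1 < m -> t.-1 < m -> {in F, forall A : {set 'I_n}, m <= #|A| <= n - m} ->
    poset_free (baton k s t) F ->
  (lubell R F <= (k - 3)%:R + m%:R / (m - s.-1)%:R + m%:R / (m - t.-1)%:R)%R.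
Proof.
move=> sm tm sizeF freeF; apply: le_trans (lubell_core_le R s t F) _.
rewrite !lerD //.
- exact/lubell_chain_bound/core_chain_bound.
- by apply: lubell_few_below => // A /sizeF/andP[].
- by apply: lubell_few_above => // A /sizeF; lia.
Qed.

End LubellBatonFree.

Lemma leq_bin2rS n i : i.*2 < n -> 'C(n, i) <= 'C(n, i.+1).
Proof.
move=> i2n; rewrite -(leq_pmul2l (ltn0Sn i)) mul_bin_left leq_mul2r.
by apply/orP; right; lia.
Qed.

Lemma leq_bin2r n i j : i <= j -> i + j <= n -> 'C(n, i) <= 'C(n, j).
Proof.
have lower_half j' : i <= j' -> j'.*2 <= n -> 'C(n, i) <= 'C(n, j').
  elim: j' => [|j' IH]; first by rewrite leqn0 => /eqP ->.
  rewrite leq_eqVlt => /predU1P[-> //|ij] j2n.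
  by apply: leq_trans (IH _ _) (leq_bin2rS _); lia.
move=> ij ijn; have [|nj] := leqP j.*2 n; first exact: lower_half.
by rewrite -[leqRHS]bin_sub; [apply: lower_half|]; lia.
Qed.

Lemma leq_bin_half n i : 'C(n, i) <= 'C(n, n %/ 2).
Proof.
have [ni|i_n] := ltnP n i; first by rewrite bin_small.
have [ih|hi] := leqP i (n %/ 2); first by apply: leq_bin2r; lia.
by rewrite -bin_sub //; apply: leq_bin2r; lia.
Qed.

Lemma leq_expn_bin b n m e :
  b.+1 * (m + e) <= n -> b ^ e * 'C(n, m) <= 'C(n, m + e).
Proof.
elim: e => [|e IH] men; first by rewrite mul1n addn0.
have {}IH : b ^ e * 'C(n, m) <= 'C(n, m + e).
  by apply: IH; apply: leq_trans men; rewrite leq_mul2l addnS leqnSn orbT.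
rewrite expnS -mulnA addnS; apply: leq_trans (leq_mul (leqnn b) IH) _.
rewrite -(leq_pmul2l (ltn0Sn (m + e))) mul_bin_left mulnA leq_mul2r.
by apply/orP; right; nia.
Qed.

Lemma leq_bin_half_offset n e : n %/ 2 + e <= n ->
  n %/ 2 * 'C(n, n %/ 2) <= n %/ 2 * 'C(n, n %/ 2 + e) + e ^ 2 * 'C(n, n %/ 2).
Proof.
set h := n %/ 2; elim: e => [|e IH] hen; first by rewrite !addn0.
have {}IH := IH ltac:(lia).
have le_half : 'C(n, h + e) <= 'C(n, h) := leq_bin_half _ _.
have offsetS :
    h * 'C(n, h + e) <= h * 'C(n, h + e.+1) + e.*2.+1 * 'C(n, h + e).
  have := mul_bin_left n (h + e); rewrite addnS.
  have hn : h <= n - h by rewrite /h; lia.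
  by move: 'C(n, h + e) 'C(n, _) => x y; nia.
apply: leq_trans IH _; rewrite (_ : e.+1 ^ 2 = e.*2.+1 + e ^ 2); last by lia.
rewrite mulnDl addnA leq_add2r; apply: leq_trans offsetS _.
by rewrite leq_add2l leq_mul2l le_half orbT.
Qed.

Lemma leq_sum_bin n a b x :
    (forall i, a <= i < b -> i <= n -> 'C(n, i) <= x) ->
  \sum_(a <= i < b) 'C(n, i) <= (b - a) * x.
Proof.
move=> le_x; rewrite -sum_nat_const_nat big_nat [leqRHS]big_nat.
apply: leq_sum => i abi; have [|ni] := leqP i n; first exact: le_x.
by rewrite bin_small.
Qed.

Section Levels.
Variable n : nat.
Implicit Types (F : {set {set 'I_n}}) (A : {set 'I_n}).

Definition levels a b : {set {set 'I_n}} :=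
  [set A : {set 'I_n} | a <= #|A| < b].

Lemma sum_levels (V : nmodType) (f : nat -> V) a b :
  (\sum_(A in levels a b) f #|A| = \sum_(a <= i < b) f i *+ 'C(n, i))%R.
Proof.
under [RHS]eq_bigr => i _.
  rewrite -[n in 'C(n, i)]card_ord -card_draws -sumr_const.
  under eq_bigl => A do rewrite inE.
  over.
rewrite (exchange_big_dep predT) //= [LHS]big_mkcond; apply: eq_bigr => A _.
under [RHS]eq_bigl => i do rewrite eq_sym.
by rewrite big_nat1_eq inE.
Qed.

Lemma card_levels a b : #|levels a b| = \sum_(a <= i < b) 'C(n, i).
Proof.
rewrite -sum1_card; have /= -> := @sum_levels _ (fun=> 1) a b.
by apply: eq_bigr => i _; rewrite natn.
Qed.

Lemma leq_card_below_level m : m.*2 <= n -> #|levels 0 m| <= m * 'C(n, m).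
Proof.
move=> mn; rewrite card_levels -[m in leqRHS]subn0.
by apply: leq_sum_bin => i im _; apply: leq_bin2r; lia.
Qed.

Lemma leq_card_above_level m : m.*2 <= n ->
  #|levels (n - m).+1 n.+1| <= m * 'C(n, m).
Proof.
move=> mn; rewrite card_levels.
rewrite [m in leqRHS](_ : m = n.+1 - (n - m).+1); last by lia.
by apply: leq_sum_bin => i im ni; rewrite -bin_sub //; apply: leq_bin2r; lia.
Qed.

Lemma leq_card_trim m F : m.*2 <= n ->
  #|F| <= #|F :&: levels m (n - m).+1| + m.*2 * 'C(n, m).
Proof.
move=> mn; rewrite -addnn mulnDl.
have outside := leq_add (leq_card_below_level mn) (leq_card_above_level mn).
rewrite -(cardsID (levels m (n - m).+1) F) leq_add2l; apply: leq_trans outside.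
apply: leq_trans (leq_card_setU _ _); apply: subset_leq_card.
by apply/subsetP => A; rewrite !inE; have := leq_card_ord A; lia.
Qed.

(* Writing x_i for the fraction of level i lying in F, the size of F is
   \sum_i ('C(n, i) - T) x_i + T * lubell F, and T separates the levels where
   'C(n, i) - T is nonnegative from those where it is nonpositive. *)
Lemma card_le_lubell (R : realFieldType) F T a b : b <= n.+1 ->
    (forall i, a <= i < b -> T <= 'C(n, i)) ->
    (forall i, i <= n -> ~~ (a <= i < b) -> 'C(n, i) <= T) ->
  (#|F|%:R <= \sum_(a <= i < b) ('C(n, i)%:R - T%:R) + T%:R * lubell R F)%R.
Proof.
move=> bn T_le le_T.
pose w i : R := (('C(n, i)%:R - T%:R) / 'C(n, i)%:R)%R.
have bin_neq0 i : i <= n -> ('C(n, i)%:R != 0 :> R)%R.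
  by move=> i_n; rewrite gt_eqF ?natr_bin_gt0.
have -> : (\sum_(a <= i < b) ('C(n, i)%:R - T%:R) =
          \sum_(A in levels a b) w #|A|)%R.
  rewrite sum_levels big_nat [RHS]big_nat; apply: eq_bigr => i abi.
  by rewrite -[RHS]mulr_natr /w divfK // bin_neq0; lia.
have -> : (#|F|%:R = \sum_(A in F) w #|A| + T%:R * lubell R F)%R.
  rewrite -sum1_card natr_sum /lubell mulr_sumr -big_split /=.
  apply: eq_bigr => A _; rewrite /w; have := bin_neq0 _ (leq_card_ord A) => ?.
  by field.
rewrite lerD2r big_mkcond [leRHS]big_mkcond; apply: ler_sum => A _.
have inv_ge0 : (0 <= 'C(n, #|A|)%:R^-1 :> R)%R by rewrite invr_ge0.
rewrite [A \in levels _ _]inE; case: ifP => AF; case: ifP => abA //.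
  by rewrite mulr_le0_ge0 // subr_le0 ler_nat le_T ?abA ?leq_card_ord.
by rewrite mulr_ge0 // subr_ge0 ler_nat T_le.
Qed.

Lemma baton_homo_gap k s t (f : baton k s t -> nat) : 2 < k ->
    {homo f : x y / baton_gen x y >-> x < y} ->
  forall i j, f (inl (inl i)) + (k - 1) <= f (inr j).
Proof.
move=> k2 f_homo i j.
have middle_ge m (mk : m < k - 2) :
    f (inl (inl i)) + m < f (inl (inr (Ordinal mk))).
  elim: m mk => [|m IH] mk; first by rewrite addn0; apply: f_homo.
  by rewrite addnS; apply: leq_ltn_trans (IH (ltnW mk)) _; apply: f_homo => /=.
have k3 : k - 3 < k - 2 by lia.
have last_lt : f (inl (inr (Ordinal k3))) < f (inr j).
  by apply: f_homo => /=; apply/eqP; lia.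
by have := middle_ge _ k3; lia.
Qed.

Lemma levels_baton_free a b k s t :
  2 < k -> 0 < s -> 0 < t -> b - a < k -> poset_free (baton k s t) (levels a b).
Proof.
move=> k2 s0 t0 bak; apply/negP => /containsP[f [f_inj f_homo]].
have card_homo : {homo (fun x => #|val (f x)|) : x y / baton_gen x y >-> x < y}.
  move=> x y xy; apply: proper_card; rewrite -lt_family_posetE lt_neqAle.
  rewrite f_homo ?le_batonE ?connect1 // andbT.
  by apply: contraTneq (baton_gen_rank xy) => /f_inj ->; rewrite ltnn.
have := baton_homo_gap k2 card_homo (Ordinal s0) (Ordinal t0).
have := valP (f (inl (inl (Ordinal s0)))); have := valP (f (inr (Ordinal t0))).
by rewrite !inE; move: #|_| #|_| => top bottom; lia.
Qed.

End Levels.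

Definition mid_lo n k : nat := (n - (k - 2)) %/ 2.

Definition mid_hi n k : nat := ((n + (k - 2)) %/ 2).+1.

(* A largest level outside the k - 1 middle levels
   mid_lo n k <= i < mid_hi n k. *)
Definition outer_bin n k : nat := 'C(n, (n + k) %/ 2).

Lemma outer_bin_deficit n k : 1 < n -> k <= n ->
  n * 'C(n, n %/ 2) <= n * outer_bin n k + 3 * k ^ 2 * 'C(n, n %/ 2).
Proof.
move=> n1 k_n; pose e := (n + k) %/ 2 - n %/ 2.
have e_n : n %/ 2 + e <= n by rewrite /e; lia.
have e_k : e ^ 2 <= k ^ 2 by rewrite leq_exp2r // /e; lia.
have half_n : n <= 3 * (n %/ 2) by lia.
have := leq_bin_half_offset e_n; rewrite subnKC; last by lia.
have := leq_bin_half n ((n + k) %/ 2); rewrite -/(outer_bin n k).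
move: (outer_bin n k) 'C(n, n %/ 2) (n %/ 2) (e ^ 2) (k ^ 2) half_n e_k.
by move=> T C h e2 k2; nia.
Qed.

Section MiddleLevels.
Variables (n k : nat).
Hypotheses (k_gt1 : 1 < k) (k_le_n : k <= n).

Lemma mid_width : mid_hi n k - mid_lo n k = k - 1.
Proof. by rewrite /mid_hi /mid_lo; lia. Qed.

Lemma leq_outer_bin i :
  mid_lo n k <= i < mid_hi n k -> outer_bin n k <= 'C(n, i).
Proof.
rewrite /mid_hi /mid_lo /outer_bin => mid_i; rewrite -bin_sub; last by lia.
by apply: leq_bin2r; lia.
Qed.

Lemma outer_bin_max i : i <= n ->
  ~~ (mid_lo n k <= i < mid_hi n k) -> 'C(n, i) <= outer_bin n k.
Proof.
rewrite /mid_hi /mid_lo /outer_bin => i_n outer_i.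
have [ik|ik] := leqP ((n + k) %/ 2) i; last by apply: leq_bin2r; lia.
by rewrite -bin_sub //; apply: leq_bin2r; lia.
Qed.

Lemma sum_mid_bin_le :
  \sum_(mid_lo n k <= i < mid_hi n k) 'C(n, i) <= (k - 1) * 'C(n, n %/ 2).
Proof.
by rewrite -mid_width; apply: leq_sum_bin => i _ _; exact: leq_bin_half.
Qed.

Lemma sum_mid_bin_ge :
  (k - 1) * outer_bin n k <= \sum_(mid_lo n k <= i < mid_hi n k) 'C(n, i).
Proof.
rewrite -mid_width -sum_nat_const_nat big_nat [leqRHS]big_nat.
exact: leq_sum leq_outer_bin.
Qed.

Lemma card_le_lubell_mid (R : realFieldType) (F : {set {set 'I_n}}) :
  (#|F|%:R <= \sum_(mid_lo n k <= i < mid_hi n k) 'C(n, i)%:R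
              + (outer_bin n k)%:R * (lubell R F - (k%:R - 1)))%R.
Proof.
have hi_n : mid_hi n k <= n.+1 by rewrite /mid_hi; lia.
apply: le_trans (card_le_lubell R F hi_n leq_outer_bin outer_bin_max) _.
rewrite sumrB sumr_const_nat mid_width -[X in (_ - X + _)%R]mulr_natr.
by rewrite natrB; [lra|lia].
Qed.

End MiddleLevels.

Section BatonFreeFamilies.
Variables (n k s t : nat).
Hypotheses (k_gt2 : 2 < k) (k_le_n : k <= n) (s_gt0 : 0 < s) (t_gt0 : 0 < t).

Lemma sum_mid_bin_le_La :
  \sum_(mid_lo n k <= i < mid_hi n k) 'C(n, i) <= La n (baton k s t).
Proof.
rewrite -card_levels; apply: leq_bigmax_cond.
by apply: levels_baton_free => //; rewrite mid_width; lia.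
Qed.

Lemma card_baton_free_le (R : realFieldType) m (F : {set {set 'I_n}}) :
    s.-1 < m -> t.-1 < m -> m.*2 <= n -> poset_free (baton k s t) F ->
  (#|F|%:R <= \sum_(mid_lo n k <= i < mid_hi n k) 'C(n, i)%:R
     + (outer_bin n k)%:R
       * ((m%:R / (m - s.-1)%:R - 1) + (m%:R / (m - t.-1)%:R - 1))
     + (m.*2 * 'C(n, m))%:R :> R)%R.
Proof.
move=> sm tm mn freeF; pose trimmed := F :&: levels n m (n - m).+1.
have size_trimmed : {in trimmed, forall A : {set 'I_n}, m <= #|A| <= n - m}.
  by move=> A; rewrite !inE => /andP[].
have free_trimmed : poset_free (baton k s t) trimmed.
  exact: poset_freeS (subsetIl F _) freeF.
have weight := lubell_baton_free R k_gt2 s_gt0 t_gt0 sm tm size_trimmed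
  free_trimmed.
have := leq_card_trim F mn; rewrite -(ler_nat R) natrD => /le_trans; apply.
rewrite lerD2r; apply: le_trans (card_le_lubell_mid (ltnW k_gt2) k_le_n R _) _.
rewrite lerD2l ler_wpM2l // lerBlDr; apply: le_trans weight _.
by rewrite natrB //; lra.
Qed.

End BatonFreeFamilies.

Local Open Scope classical_set_scope.
Local Open Scope ring_scope.

Lemma La_natr_le (R : realFieldType) (d : Order.disp_t) (H : finPOrderType d)
    n (x : R) : 0 <= x ->
  (forall F : {set {set 'I_n}}, poset_free H F -> #|F|%:R <= x) ->
  (La n H)%:R <= x.
Proof.
move=> x0 F_le; rewrite /La; elim/big_ind: _ => // a b ax bx.
by rewrite /maxn; case: ifP.
Qed.

Lemma near_leq_expn_exp2 e c : (0 < c)%N ->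
  \forall n \near \oo, (n ^ e <= 2 ^ (n %/ c))%N.
Proof.
move=> c0; near=> n; set b := (e.+1 * c)%N; set j := (n %/ b)%N.
have b0 : (0 < b)%N by rewrite muln_gt0.
have nj : (n <= b * j.+1)%N by rewrite mulnC ltnW // ltn_ceil.
have bj : (b ^ e <= j.+1)%N.
  apply: leqW; rewrite leq_divRL // mulnC -expnS.
  by near: n; exact: nbhs_infty_ge.
apply: (@leq_trans (j.+1 ^ e.+1)).
  apply: (@leq_trans (b ^ e * j.+1 ^ e)).
    by rewrite -expnMn; have [->//|e0] := posnP e; rewrite leq_exp2r.
  by rewrite expnS leq_mul2r bj orbT.
apply: (@leq_trans ((2 ^ j) ^ e.+1)); first by rewrite leq_exp2r // ltn_expl.
rewrite -expnM leq_exp2l // leq_divRL // -mulnA; exact: leq_divM.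
Unshelve. all: by end_near. Qed.

Lemma near_tail_le_outer_bin k : \forall n \near \oo,
  (n ^ 2 * ((n %/ 4).*2 * 'C(n, n %/ 4)) <= outer_bin n k)%N.
Proof.
near=> n.
have n_large : (3 * k <= n)%N by near: n; exact: nbhs_infty_ge.
apply: (@leq_trans (n ^ 3 * 'C(n, n %/ 4))).
  by rewrite mulnA leq_mul2r [(n ^ 3)%N]expnSr leq_mul2l; lia.
apply: (@leq_trans (2 ^ (n %/ 12) * 'C(n, n %/ 4))).
  rewrite leq_mul2r; apply/orP; right.
  by near: n; exact: near_leq_expn_exp2.
apply: leq_trans (leq_expn_bin _) _; first by lia.
by apply: leq_bin2r; lia.
Unshelve. all: by end_near. Qed.

Lemma near_quarter_excess_le (R : realFieldType) r : \forall n \near \oo,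
  (n %/ 4)%:R / (n %/ 4 - r)%:R - 1 <= 6 * r%:R / n%:R :> R.
Proof.
near=> n; have n_large : (12 * r + 9 <= n)%N by near: n; exact: nbhs_infty_ge.
have rm : (r < n %/ 4)%N by lia.
have mr0 : 0 < (n %/ 4 - r)%:R :> R by rewrite ltr0n subn_gt0.
have n0 : 0 < n%:R :> R by rewrite ltr0n; lia.
rewrite lerBlDr ler_pdivrMr // mulrDl mul1r mulrAC -lerBlDr.
rewrite ler_pdivlMr // -natrB; last by lia.
rewrite -!natrM ler_nat subnBA ?addKn; last by lia.
by rewrite mulnAC [leqRHS]mulnC leq_mul2l; lia.
Unshelve. all: by end_near. Qed.

Lemma near_La_baton_le (R : realFieldType) k s t :
    (2 < k)%N -> (0 < s)%N -> (0 < t)%N ->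
  \forall n \near \oo,
    (La n (baton k s t))%:R <=
      \sum_(mid_lo n k <= i < mid_hi n k) 'C(n, i)%:R
      + (outer_bin n k)%:R
        * (2 * k%:R * (s%:R + t%:R - 2) / n%:R + (n%:R ^+ 2)^-1) :> R.
Proof.
move=> k2 s0 t0; near=> n.
have n_large : (k + 4 * (s + t) + 4 <= n)%N by near: n; exact: nbhs_infty_ge.
have tail : (n ^ 2 * ((n %/ 4).*2 * 'C(n, n %/ 4)) <= outer_bin n k)%N.
  by near: n; exact: near_tail_le_outer_bin.
have excess_s :
    (n %/ 4)%:R / (n %/ 4 - s.-1)%:R - 1 <= 6 * (s.-1)%:R / n%:R :> R.
  by near: n; exact: near_quarter_excess_le.
have excess_t :
    (n %/ 4)%:R / (n %/ 4 - t.-1)%:R - 1 <= 6 * (t.-1)%:R / n%:R :> R.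
  by near: n; exact: near_quarter_excess_le.
have st2 : s%:R + t%:R - 2 = (s.-1)%:R + (t.-1)%:R :> R.
  by rewrite -[in LHS](prednK s0) -[in LHS](prednK t0) -!natr1; ring.
have n0 : 0 < n%:R :> R by rewrite ltr0n; lia.
apply: La_natr_le => [|F freeF].
  by rewrite st2 addr_ge0 ?sumr_ge0 // mulr_ge0.
have [k_n sm tm mn] :
    [/\ k <= n, s.-1 < n %/ 4, t.-1 < n %/ 4 & (n %/ 4).*2 <= n]%N.
  by split; lia.
apply: le_trans (card_baton_free_le k2 k_n s0 t0 R sm tm mn freeF) _.
rewrite [X in _ <= _ + X]mulrDr [leRHS]addrA lerD //.
  rewrite lerD2l ler_wpM2l //; apply: le_trans (lerD excess_s excess_t) _.
  rewrite st2 -mulrDl -mulrDr ler_pM2r ?invr_gt0 // ler_wpM2r //.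
  by rewrite -natrM ler_nat; lia.
by rewrite ler_pdivlMr ?exprn_gt0 // -natrX -natrM ler_nat mulnC.
Unshelve. all: by end_near. Qed.

Lemma outer_bin_ratio_ge (R : realFieldType) n k : (1 < n)%N -> (k <= n)%N ->
  1 - 3 * k%:R ^+ 2 / n%:R <= (outer_bin n k)%:R / 'C(n, n %/ 2)%:R :> R.
Proof.
move=> n1 k_n; have n0 : 0 < n%:R :> R by rewrite ltr0n ltnW.
rewrite ler_pdivlMr ?natr_bin_gt0 ?leq_div // -(ler_pM2l n0) mulrA mulrBr mulr1.
rewrite [X in _ - X]mulrC divfK ?gt_eqF // mulrBl lerBlDr.
by rewrite -natrX -!natrM -natrD ler_nat outer_bin_deficit.
Qed.

Lemma cvg_addM_invn (R : realType) (a c : R) : a + c / n%:R @[n --> \oo] --> a.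
Proof.
rewrite -[X in _ --> X]addr0; apply: cvgD; first exact: cvg_cst.
rewrite -[X in _ --> X](mulr0 c); apply: cvgM; first exact: cvg_cst.
apply/gtr0_cvgV0; last exact: cvgr_idn.
by near=> n; rewrite ltr0n; near: n; exact: nbhs_infty_gt.
Unshelve. all: by end_near. Qed.

Lemma cvg_outer_bin_ratio (R : realType) k :
  (outer_bin n k)%:R / 'C(n, n %/ 2)%:R @[n --> \oo] --> (1 : R).
Proof.
apply: (@squeeze_cvgr _ _ _ _
  (fun n => 1 + - (3 * k%:R ^+ 2) / n%:R) (cst 1)).
- near=> n; apply/andP; split; last first.
    by rewrite ler_pdivrMr ?mul1r ?natr_bin_gt0 ?ler_nat ?leq_bin_half ?leq_div.
  by rewrite mulNr outer_bin_ratio_ge //; near: n; exact: nbhs_infty_ge.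
- exact: cvg_addM_invn.
- exact: cvg_cst.
Unshelve. all: by end_near. Qed.

Lemma near_La_baton_ratio_le (R : realFieldType) k s t :
    (2 < k)%N -> (0 < s)%N -> (0 < t)%N ->
  \forall n \near \oo, (La n (baton k s t))%:R / 'C(n, n %/ 2)%:R <=
    k%:R - 1 + (2 * k%:R * (s%:R + t%:R - 2) + 1) / n%:R :> R.
Proof.
move=> k2 s0 t0.
apply: filterS2 (near_La_baton_le R k2 s0 t0) (nbhs_infty_ge k) => n La_le k_n.
have n1 : 1 <= n%:R :> R by rewrite ler1n; lia.
have n0 := lt_le_trans ltr01 n1.
have st2 : 0 <= s%:R + t%:R - 2 :> R by rewrite subr_ge0 -natrD ler_nat; lia.
rewrite ler_pdivrMr ?natr_bin_gt0 ?leq_div //; apply: le_trans La_le _.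
rewrite [leRHS]mulrDl lerD //.
  rewrite -natr_sum -(natrB _ (ltnW (ltnW k2))) -natrM ler_nat.
  exact: sum_mid_bin_le (ltnW k2) k_n.
rewrite mulrC; apply: ler_pM => //.
- by rewrite addr_ge0 ?invr_ge0 ?divr_ge0 ?mulr_ge0 ?exprn_ge0.
- rewrite [leRHS]mulrDl lerD2l mul1r lef_pV2 ?posrE ?exprn_gt0 //.
  by rewrite expr2 ler_peMl // ltW.
- by rewrite ler_nat leq_bin_half.
Qed.

Lemma La_baton_ratio_ge (R : realFieldType) n k s t :
    (2 < k)%N -> (0 < s)%N -> (0 < t)%N -> (k <= n)%N ->
  (k%:R - 1) * ((outer_bin n k)%:R / 'C(n, n %/ 2)%:R) <=
    (La n (baton k s t))%:R / 'C(n, n %/ 2)%:R :> R.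
Proof.
move=> k2 s0 t0 k_n.
rewrite mulrA ler_wpM2r // -(natrB _ (ltnW (ltnW k2))) -natrM ler_nat.
apply: leq_trans (sum_mid_bin_ge (ltnW k2) k_n) _.
exact: sum_mid_bin_le_La.
Qed.

Lemma cvg_La_baton_ratio (R : realType) k s t :
    (2 < k)%N -> (0 < s)%N -> (0 < t)%N ->
  (La n (baton k s t))%:R / 'C(n, n %/ 2)%:R @[n --> \oo] --> (k%:R - 1 : R).
Proof.
move=> k2 s0 t0.
apply: (@squeeze_cvgr _ _ _ _
  (fun n => (k%:R - 1) * ((outer_bin n k)%:R / 'C(n, n %/ 2)%:R))
  (fun n => k%:R - 1 + (2 * k%:R * (s%:R + t%:R - 2) + 1) / n%:R)).
- apply: filterS2 (near_La_baton_ratio_le R k2 s0 t0) (nbhs_infty_ge k).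
  by move=> n -> k_n; rewrite La_baton_ratio_ge.
- rewrite -[X in _ --> X]mulr1.
  by apply: cvgM; [exact: cvg_cst|exact: cvg_outer_bin_ratio].
- exact: cvg_addM_invn.
Qed.

Lemma near_invn_sqr_le_error (R : realType) : \forall n \near \oo,
  (n%:R ^+ 2)^-1 <= n%:R `^ (- (3 / 2)) * Num.sqrt (ln n%:R) :> R.
Proof.
near=> n.
have e_n : expR 1 <= n%:R :> R by near: n; exact: nbhs_infty_ger.
have n0 : 0 < n%:R :> R := lt_le_trans (expR_gt0 1) e_n.
have n1 : 1 <= n%:R :> R by rewrite ler1n -(ltr0n R).
rewrite -[leLHS]mulr1; apply: ler_pM => //.
  rewrite -powR_invn; last exact: ltW.
  by apply: ler_powR => //; lra.
rewrite -[leLHS]sqrtr1 ler_sqrt; last exact: ln_ge0.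
by rewrite -[leLHS]expRK ler_ln ?posrE ?expR_gt0.
Unshelve. all: by end_near. Qed.

Theorem theorem1 (R : realType) (k s t : nat)
    (hk : (3 <= k)%N) (hs : (1 <= s)%N) (ht : (1 <= t)%N) :
  (exists e : nat -> R,
      e =O_\oo (fun n : nat => n%:R `^ (- (3 / 2)) * Num.sqrt (ln n%:R) : R)
   /\ \forall n \near \oo,
        (La n (baton k s t))%:R <=
          \sum_((n - (k - 2)) %/ 2 <= i < ((n + (k - 2)) %/ 2).+1) ('C(n, i))%:R
          + ('C(n, (n + k) %/ 2))%:R
            * (2 * k%:R * (s%:R + t%:R - 2) / n%:R + e n))
  /\ (fun n : nat => (La n (baton k s t))%:R / ('C(n, n %/ 2))%:R : R)
       @ \oo --> (k%:R - 1 : R).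
Proof.
split; last exact: cvg_La_baton_ratio.
exists (fun n : nat => n%:R `^ (- (3 / 2)) * Num.sqrt (ln n%:R) : R).
split; first exact: idO.
apply: filterS2 (near_La_baton_le R hk hs ht) (near_invn_sqr_le_error R).
by move=> n /le_trans + err; apply; rewrite lerD2l ler_wpM2l // lerD2l.
Qed.
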